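(* Let $k\in\mathbb{N}$, $r\in\mathbb{N}_0$ and $f\in C_B^{r}[0,\infty)$. Then for every integer $n\ge k$ with $n>r+1$ and every $x\in(0,\infty)$, $$\left|\frac{1}{b(n,k,r)}M_{n,k}^{(r)}(f;x)-f^{(r)}(x)\right|\le 2\,\omega\!\left(f^{(r)},\sqrt{\delta_n}\right),$$ where $$\delta_n=\left(\frac{4r^{2}+4r(2-k)+2n+k^{2}-5k+4}{(n-r)(n-r-1)}\right)x^{2}.$$
   Context: $\mathbb{N}_0$ denotes the non-negative integers. For $n,k\in\mathbb{N}$ with $n\ge k$, the general Gamma type operators are $$M_{n,k}(f;x)=\frac{(2n-k+1)!\,x^{n+1}}{n!\,(n-k)!}\int_0^\infty \frac{t^{n-k}}{(x+t)^{2n-k+2}}f(t)\,dt,\qquad x>0.$$ $M_{n,k}^{(r)}(f;x)$ denotes the $r$-th derivative of $x\mapsto M_{n,k}(f;x)$ (with $M_{n,k}^{(0)}=M_{n,k}$). For $0\le r\le n$, $$b(n,k,r)=\frac{(n-r)!\,(n-k+r)!}{n!\,(n-k)!}.$$ $C_B[0,\infty)$ is the space of real-valued continuous bounded functions on $[0,\infty)$ with the supremum norm, and $C_B^{r}[0,\infty)$ is the space of all $f\in C_B[0,\infty)$ such that $f',f'',\dots,f^{(r)}\in C_B[0,\infty)$ (for $r=0$ it is $C_B[0,\infty)$). The first order modulus of continuity is $$\omega(g,\delta)=\sup_{0<h\le\delta}\ \sup_{y\in[0,\infty)}|g(y+h)-g(y)|,\qquad \delta>0.$$ *)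

(* Defs.v *)
From HB Require Import structures.
From mathcomp Require Import all_boot all_order all_algebra.
From mathcomp Require Import all_classical all_reals all_analysis.

Set Implicit Arguments.
Unset Strict Implicit.
Unset Printing Implicit Defensive.

Import Order.TTheory GRing.Theory Num.Theory.
Import numFieldNormedType.Exports.

Local Open Scope classical_set_scope.
Local Open Scope ring_scope.

(* Functions on [0, oo) are represented by functions R -> R; no definition
   below depends on their values at negative arguments. *)

Definition half_line (R : realType) : set R := `[0, +oo[.
Arguments half_line R : clear implicits.

Definition halfline_quotient (R : realType) (f : R -> R) (x y : R) : R :=
  (f y - f x) / (y - x).

(* The difference quotient is only taken at points y of [0, oo) distinct from
   x: differentiability is the usual one at x > 0, and one-sided at x = 0. *)
Definition derivable_halfline (R : realType) (f : R -> R) (x : R) : Prop :=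
  cvg (halfline_quotient f x y @[y --> within (half_line R) x^']).

Definition derive_halfline (R : realType) (f : R -> R) (x : R) : R :=
  lim (halfline_quotient f x y @[y --> within (half_line R) x^']).

Definition nderive_halfline (R : realType) (r : nat) (f : R -> R) : R -> R :=
  iter r (@derive_halfline R) f.

Definition CB (R : realType) (f : R -> R) : Prop :=
  {within half_line R, continuous f} /\ [bounded f x | x in half_line R].

Definition CBr (R : realType) (r : nat) (f : R -> R) : Prop :=
  (forall i, (i < r)%N -> forall x, 0 <= x ->
     derivable_halfline (nderive_halfline i f) x) /\
  (forall i, (i <= r)%N -> CB (nderive_halfline i f)).

(* [sup] is the real supremum, which is 0 by convention on a set that is not
   bounded above; for bounded g all the sets involved are bounded. *)
Definition modulus_of_continuity (R : realType) (g : R -> R) (delta : R) : R :=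
  sup [set sup [set `|g (y + h) - g y| | y in half_line R]
      | h in `]0, delta]].

(* The subtractions in nat are exact for k <= n (and r <= n in [b_coef]). *)
Definition gamma_op (R : realType) (n k : nat) (f : R -> R) (x : R) : R :=
  ((2 * n - k + 1)`!)%:R * x ^+ n.+1 / ((n`!)%:R * ((n - k)`!)%:R) *
  \int[lebesgue_measure]_(t in half_line R)
     (t ^+ (n - k) / (x + t) ^+ (2 * n - k + 2) * f t).

Definition b_coef (R : realType) (n k r : nat) : R :=
  (((n - r)`!)%:R * ((n - k + r)`!)%:R) / ((n`!)%:R * ((n - k)`!)%:R).
Arguments b_coef R n k r : clear implicits.

(* All subtractions here are in R. *)
Definition delta_n (R : realType) (n k r : nat) (x : R) : R :=
  (4 * r%:R ^+ 2 + 4 * r%:R * (2 - k%:R) + 2 * n%:R + k%:R ^+ 2 - 5 * k%:R + 4)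
  / ((n%:R - r%:R) * (n%:R - r%:R - 1)) * x ^+ 2.

(* Main.v *)
(* Substituting [t = x u] turns [M_{n,k}(f; x)] into the average of [f (x u)]
   against the beta-prime weight [u^(n-k) / (1+u)^(2n-k+2)]. Differentiating
   under the integral sign [r] times replaces [f] by [f^(r)] and multiplies the
   weight by [u^r]; dividing by [b(n,k,r)] makes the new weight a probability
   density. It remains to average
     [|g (x u) - g x| <= (1 + (x u - x)^2 / d^2) * omega g d],
   with [g = f^(r)] and [d^2] the second moment of [x u - x], which is
   exactly [delta_n]. *)
Require Import Defs.
From mathcomp Require Import all_boot all_order all_algebra.
From mathcomp Require Import all_classical all_reals all_analysis.
From mathcomp Require Import measurable_realfun ring lra zify.
Import Order.TTheory GRing.Theory Num.Theory.
Import numFieldNormedType.Exports.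
Local Open Scope classical_set_scope.
Local Open Scope ring_scope.

(** * Continuity, boundedness and linear substitution on the half line *)

Lemma measurable_half_line {R : realType} : measurable (half_line R).
Proof. exact: measurable_itv. Qed.

Lemma half_lineE {R : realType} (x : R) : half_line R x = (0 <= x) :> Prop.
Proof. by rewrite /half_line /= in_itv /= andbT. Qed.

Lemma bounded_half_line {R : realType} (g : R -> R) :
  [bounded g x | x in half_line R] ->
  exists2 B, 0 <= B & forall z, 0 <= z -> `|g z| <= B.
Proof.
move=> [M [Mr HM]]; exists (`|M| + 1) => [|z z0]; first by rewrite addr_ge0.
apply: (HM (`|M| + 1)); first by rewrite (le_lt_trans (ler_norm M)) // ltrDl.
by rewrite -half_lineE in z0.
Qed.

Lemma within_half_line_comp_scale {R : realType} (c : R) (g : R -> R) :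
  0 < c -> {within half_line R, continuous g} ->
  {within half_line R, continuous (fun u => g (c * u))}.
Proof.
move=> c0 /subspace_continuousP cg; apply/subspace_continuousP => u u0.
rewrite half_lineE in u0.
apply: (@cvg_comp _ _ _ (fun u => c * u) g _ (within (half_line R) (nbhs (c * u)))).
  move=> A [e /= e0 Ae].
  have : \forall v \near u, ball (c * u) e (c * v).
    have /cvgrPdist_lt : c * v @[v --> u] --> c * u by apply: cvgMr; exact: cvg_id.
    by move=> /(_ e e0); apply: filterS => v; rewrite /ball /=.
  rewrite nbhs_filterE /= /fmap /= /within /=.
  apply: filterS => v + v0; move/Ae; apply.
  by move: v0; rewrite !half_lineE => v0; rewrite mulr_ge0 // ltW.
by apply: cg; rewrite half_lineE mulr_ge0 // ltW.
Qed.

Lemma within_continuous_mul {R : realType} (A : set R) (f g : R -> R) :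
  {within A, continuous f} -> {within A, continuous g} ->
  {within A, continuous (fun u => f u * g u)}.
Proof. by move=> cf cg x; apply: cvgM; [exact: cf|exact: cg]. Qed.

(** Substitution is carried out on the positive and negative parts of [G] separately, as an identity
    between extended nonnegative integrals. Since [c > 0], the factor [c] passes through both
    parts. *)
Lemma Rintegral_half_line_scale {R : realType} (c : R) (G : R -> R) :
  0 < c -> {within half_line R, continuous G} ->
  \int[lebesgue_measure]_(t in half_line R) G t =
  \int[lebesgue_measure]_(u in half_line R) (c * G (c * u)).
Proof.
move=> c0 cG.
have nonneg (H : R -> R) : {within half_line R, continuous H} ->
    (forall t, 0 <= H t) ->
    (\int[lebesgue_measure]_(t in half_line R) (H t)%:E =
     \int[lebesgue_measure]_(u in half_line R) (c * H (c * u))%:E)%E.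
  move=> cH H0.
  have dF : derive1 (fun u : R => c * u) = cst c.
    by apply/funext => u; rewrite derive1Ml// derive1_id mulr1.
  have := @increasing_ge0_integration_by_substitutiony R (fun u => c * u) H 0.
  rewrite mulr0 => -> //.
  - by apply: eq_integral => u _ /=; rewrite dF fctE mulrC.
  - by move=> a b _ _ ab; rewrite ltr_pM2l.
  - by rewrite dF => u _; exact: cvg_cst.
  - by rewrite dF; exact: is_cvg_cst.
  - by rewrite dF; exact: is_cvg_cst.
  - split => //.
    by apply: cvg_at_right_filter; apply: cvgMr; exact: cvg_id.
  - by apply: gt0_cvgMry.
have cpos (H : R -> R) : {within half_line R, continuous H} ->
    {within half_line R, continuous (H^\+)%R}.
  move=> cH x; rewrite /funrpos.
  by apply: (@continuous_max _ (subspace (half_line R)) H (fun=> 0) x); [exact: cH|exact: cvg_cst].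
have cneg : {within half_line R, continuous (G^\-)%R}.
  move=> x; rewrite /funrneg.
  apply: (@continuous_max _ (subspace (half_line R)) (fun u => - G u) (fun=> 0) x); last exact: cvg_cst.
  by apply: cvgN; exact: cG.
congr fine.
rewrite [LHS]integralE [RHS]integralE; congr (_ - _)%E.
- have := nonneg _ (cpos _ cG) (funrpos_ge0 _) => /=.
  under eq_integral do rewrite -[(_ _)%:E]/((EFin \o _) _) -funerpos.
  move=> ->; apply: eq_integral => u _.
  rewrite -[fun x => (c * G (c * x))%:E]/(EFin \o (fun x => c * G (c * x))) funerpos /=.
  by rewrite ge0_funrposM ?ltW.
- have := nonneg _ cneg (funrneg_ge0 _) => /=.
  under eq_integral do rewrite -[(_ _)%:E]/((EFin \o _) _) -funerneg.
  move=> ->; apply: eq_integral => u _.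
  rewrite -[fun x => (c * G (c * x))%:E]/(EFin \o (fun x => c * G (c * x))) funerneg /=.
  by rewrite ge0_funrnegM ?ltW.
Qed.

(** * Beta-prime weights: derivatives, integrals, integrability *)

(** For [p > a + 1], the unnormalised density of the beta-prime law with parameters [a + 1] and
    [p - a - 1]. *)
Definition beta_weight {R : realType} (a p : nat) (u : R) : R :=
  u ^+ a / (1 + u) ^+ p.

(** Euler's Beta function at [(a + 1, b + 1)], which is the total mass of the weight with
    [p = a + b + 2]. *)
Definition beta_value {R : realType} (a b : nat) : R :=
  (a`!)%:R * (b`!)%:R / ((a + b + 1)`!)%:R.

Lemma beta_weight_ge0 {R : realType} (a p : nat) (u : R) :
  0 <= u -> 0 <= beta_weight a p u.
Proof.
by move=> u0; rewrite /beta_weight divr_ge0 ?exprn_ge0 ?addr_ge0.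
Qed.

(** For [a = 0] the truncated [a.-1] is harmless, its term being multiplied by [a%:R = 0]. *)
Lemma is_derive_beta_weight {R : realType} (a p : nat) (u : R) : 0 <= u ->
  is_derive u 1 (@beta_weight R a p)
    (a%:R * beta_weight a.-1 p u - p%:R * beta_weight a p.+1 u).
Proof.
move=> u0.
have u1 : 1 + u != 0 by rewrite gt_eqF// ltr_pwDl.
have h : (1 + u) ^+ p != 0 by rewrite expf_neq0.
have d1 : is_derive u 1 (fun v : R => (1 + v) ^+ p) (p%:R * (1 + u) ^+ p.-1).
  have : is_derive u 1 (fun v : R => 1 + v) 1.
    by rewrite -[X in is_derive _ _ _ X]add0r; apply: is_deriveD.
  move=> /(is_deriveX p); rewrite fctE => /is_derive_eq; apply.
  by rewrite /GRing.scale /= mulr1.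
have d2 := @is_deriveV R (fun v : R => (1 + v) ^+ p) u _ 1 h d1.
have d3 : is_derive u 1 (fun v : R => v ^+ a) (a%:R * u ^+ a.-1).
  have := is_deriveX a (is_derive_id u (1 : R)); rewrite fctE => /is_derive_eq.
    by apply; rewrite /GRing.scale /= mulr1.
have := is_deriveM d3 d2.
rewrite /beta_weight => /is_derive_eq; apply; rewrite /GRing.scale /=.
case: p h d1 d2 => [|p] h d1 d2 /=; first by rewrite !expr0; field.
rewrite !exprS; field.
by rewrite u1 /= expf_neq0.
Qed.

(** The denominator has at least one more power than the numerator: [u^a <= (1+u)^a] and
    [u <= (1+u)^(b+1)] squeeze the weight below [1/u]. *)
Lemma beta_weight_cvgy {R : realType} (a b : nat) :
  @beta_weight R a (a + b.+1) u @[u --> +oo] --> 0.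
Proof.
have bnd : \forall u \near +oo, 0 <= @beta_weight R a (a + b.+1) u <= u^-1.
  near=> u.
  have u0 : 0 < u by [].
  have u1 : 0 < 1 + u by rewrite addr_gt0.
  rewrite beta_weight_ge0 ?(ltW u0) //=.
  rewrite /beta_weight exprD -invf_div exprS invf_div.
  rewrite ler_pdivrMr ?mulr_gt0 ?exprn_gt0 //.
  rewrite mulrCA -[leLHS]mulr1 ler_pM ?exprn_ge0 ?(ltW u0) //.
    by rewrite lerXn2r ?nnegrE ?(ltW u0) ?(ltW u1) // lerDr.
  rewrite mulrA -[leLHS]mulr1 ler_pM //.
    by rewrite mulrC ler_pdivlMr // mul1r lerDr.
  by rewrite exprn_ege1 // lerDl ltW.
apply: (squeeze_cvgr bnd); first exact: cvg_cst.
have pos : \forall u \near +oo, 0 < (fun v : R => v) u by exact: nbhs_pinfty_gt.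
have h := (gtr0_cvgV0 pos).2 (fun A H => H); exact: h.
Unshelve. all: by end_near. Qed.

(* Integrating the derivative of [u^(a+1) / (1+u)^(a+b+2)] expresses the weight
   with [a+1] through the one with [a]; producing the antiderivative itself
   avoids integrating by parts on an unbounded interval. *)
Lemma beta_antiderivative {R : realType} (a b : nat) : exists F : R -> R,
  [/\ forall u : R, 0 <= u -> is_derive u 1 F (beta_weight a (a + b + 2) u),
      F 0 = 0 & F u @[u --> +oo] --> @beta_value R a b].
Proof.
elim: a => [|a [F [dF F0 Fy]]].
  (* The elementary primitive of [(1+u)^-(b+2)], with its constant chosen to vanish at 0. *)
  exists (fun u => b.+1%:R^-1 * (1 - beta_weight 0 b.+1 u)); split.
  - move=> u u0.
    have d := is_derive_beta_weight 0 b.+1 u u0.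
    have d1 := is_deriveB (is_derive_cst (1 : R) u 1) d.
    have d2 := is_deriveZ b.+1%:R^-1 d1.
    have := is_derive_eq d2; apply.
    rewrite /GRing.scale /= /beta_weight add0n addn2; field.
    by rewrite !expf_neq0 ?gt_eqF // ltr_pwDl.
  - by rewrite /beta_weight addr0 !expr1n expr0 invr1 mulr1 subrr mulr0.
  - have -> : @beta_value R 0 b = b.+1%:R^-1 * (1 - 0).
      rewrite /beta_value add0n addn1 factS natrM fact0 subr0 mulr1 mul1r.
      by rewrite invfM mulrCA divff ?mulr1 // pnatr_eq0 -lt0n fact_gt0.
    apply: cvgMr; apply: cvgB; first exact: cvg_cst.
    exact: (beta_weight_cvgy 0 b).
pose p := (a + b + 2)%N.
have p0 : p%:R != 0 :> R by rewrite pnatr_eq0 /p addn2.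
exists (fun u => p%:R^-1 * (a.+1%:R * F u - beta_weight a.+1 p u)); split.
- move=> u u0.
  have d := is_derive_beta_weight a.+1 p u u0.
  have d1 := is_deriveB (is_deriveZ a.+1%:R (dF u u0)) d.
  have d2 := is_deriveZ p%:R^-1 d1.
  have := is_derive_eq d2; apply.
  rewrite /GRing.scale /= -/p (_ : a.+1 + b + 2 = p.+1)%N //.
  by rewrite opprB addrC subrK mulrA mulVf // mul1r.
- by rewrite F0 /beta_weight expr0n mul0r mulr0 subrr mulr0.
- have -> : @beta_value R a.+1 b = p%:R^-1 * (a.+1%:R * beta_value a b - 0).
    have pE : p = (a + b + 1).+1 by rewrite /p addn2 addn1.
    rewrite /beta_value subr0 !addSn (factS (a + b + 1)) -pE (factS a) !natrM.
    move: p0; move: (p%:R : R) => q q0; field.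
    by rewrite q0 pnatr_eq0 -lt0n fact_gt0.
  apply: cvgMr; apply: cvgB; first exact: cvgMr.
  by have := @beta_weight_cvgy R a.+1 b; rewrite addSn addnS /p addn2.
Qed.

Lemma within_continuous_beta_weight {R : realType} (a p : nat) :
  {within half_line R, continuous (@beta_weight R a p)}.
Proof.
apply/subspace_continuousP => u; rewrite half_lineE => u0.
apply: cvg_within_filter.
have [d _] := is_derive_beta_weight a p u u0.
by apply/differentiable_continuous/derivable1_diffP.
Qed.

Lemma integral_beta_weight {R : realType} (a b : nat) :
  (\int[lebesgue_measure]_(u in half_line R)
     (beta_weight a (a + b + 2) u)%:E)%E = (beta_value a b)%:E.
Proof.
have [F [dF F0 Fy]] := @beta_antiderivative R a b.
rewrite (@ge0_continuous_FTC2y _ _ F 0 (beta_value a b)) ?F0 ?sube0 //.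
- by move=> u; exact: beta_weight_ge0.
- exact: within_continuous_beta_weight.
- by move=> u /ltW /dF [].
- apply: cvg_at_right_filter; have [d _] := dF 0 (lexx 0).
  suff : F u @[u --> (0 : R)] --> F 0 by rewrite F0.
  by apply/differentiable_continuous/derivable1_diffP.
- move=> u; rewrite in_itv /= andbT => /ltW /dF d.
  by rewrite derive1E; apply: derive_val.
Qed.

Section IntegrableEFin.
Context {R : realType} {D : set R} {f g : R -> R}.
Hypothesis mD : measurable D.
Hypothesis intf : lebesgue_measure.-integrable D (EFin \o f).
Hypothesis intg : lebesgue_measure.-integrable D (EFin \o g).

Lemma integrable_EFinD :
  lebesgue_measure.-integrable D (EFin \o (fun u => f u + g u)).
Proof. exact: (integrableD _ intf intg). Qed.

Lemma integrable_EFinB :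
  lebesgue_measure.-integrable D (EFin \o (fun u => f u - g u)).
Proof. exact: (integrableB _ intf intg). Qed.

Lemma integrable_EFinZl (c : R) :
  lebesgue_measure.-integrable D (EFin \o (fun u => c * f u)).
Proof. exact: (integrableZl _ c intf). Qed.

End IntegrableEFin.

Lemma integrable_beta_weight {R : realType} (a b : nat) :
  lebesgue_measure.-integrable (half_line R)
    (EFin \o @beta_weight R a (a + b + 2)).
Proof.
apply/integrableP; split.
  apply/measurable_EFinP; apply: subspace_continuous_measurable_fun.
    exact: measurable_half_line.
  exact: within_continuous_beta_weight.
under eq_integral => u.
  rewrite inE half_lineE => u0 /=; rewrite ger0_norm ?beta_weight_ge0 //.
  over.
by rewrite /= integral_beta_weight ltry.
Qed.

Lemma integrable_beta_weight_CB {R : realType} (a b : nat) (g : R -> R) (x : R) :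
  0 < x -> CB g ->
  lebesgue_measure.-integrable (half_line R)
    (EFin \o (fun u => beta_weight a (a + b + 2) u * g (x * u))).
Proof.
move=> x0 [cg /bounded_half_line[B _ gB]].
have cw := @within_continuous_beta_weight R a (a + b + 2).
have int : lebesgue_measure.-integrable (half_line R)
    (EFin \o (fun u => B * beta_weight a (a + b + 2) u)).
  by apply: integrable_EFinZl; [exact: measurable_half_line|exact: integrable_beta_weight].
apply: (le_integrable _ _ _ int); first exact: measurable_half_line.
- apply/measurable_EFinP; apply: subspace_continuous_measurable_fun.
    exact: measurable_half_line.
  apply: within_continuous_mul => //.
  exact: within_half_line_comp_scale.
- move=> u; rewrite half_lineE => u0 /=; rewrite lee_fin !normrM mulrC.
  rewrite ler_wpM2r // (le_trans (gB _ _)) ?ler_norm // mulr_ge0 // ltW //.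
Qed.

(** * Modulus of continuity of a bounded function *)

Section Modulus.
Variables (R : realType) (g : R -> R).
Hypothesis bg : [bounded g x | x in half_line R].

(** Twice a bound of [|g|] bounds every increment, so the inner and outer sets are bounded above and
    neither [sup] takes its default value. *)
Lemma le_modulus_of_continuity (d h y : R) : 0 < h -> h <= d -> 0 <= y ->
  `|g (y + h) - g y| <= modulus_of_continuity g d.
Proof.
have [B _ gB] := bounded_half_line g bg.
have incB a z : 0 < a -> 0 <= z -> `|g (z + a) - g z| <= B + B.
  move=> a0 z0; apply: le_trans (ler_normB _ _) _.
  by rewrite lerD ?gB // addr_ge0 // ltW.
move=> h0 hd y0; rewrite /modulus_of_continuity.
have inner a : 0 < a -> has_sup [set `|g (z + a) - g z| | z in half_line R].
  move=> a0; split.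
    by exists `|g (0 + a) - g 0|, 0 => //; rewrite half_lineE.
  exists (B + B) => _ [z z0 <-].
  by apply: incB => //; move: z0; rewrite half_lineE.
apply: (@le_trans _ _ (sup [set `|g (z + h) - g z| | z in half_line R])).
  apply: ub_le_sup; first exact: (inner h h0).2.
  by exists y => //; rewrite half_lineE.
apply: ub_le_sup; last by exists h => //; rewrite /= in_itv /= h0.
exists (B + B) => _ [a + <-]; rewrite /= in_itv /= => /andP[a0 ad].
apply: ge_sup; first exact: (inner a a0).1.
move=> _ [z z0 <-].
by apply: incB => //; move: z0; rewrite half_lineE.
Qed.

Lemma modulus_of_continuity_ge0 (d : R) : 0 < d -> 0 <= modulus_of_continuity g d.
Proof.
by move=> d0; apply: le_trans (le_modulus_of_continuity d d 0 d0 _ _).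
Qed.

(** Chaining: as long as [z] is farther than [d] from [y], one step of length exactly [d] is peeled
    off at [z]; the remaining increment fits in a single step. *)
Lemma le_mul_modulus_of_continuity (m : nat) (d y z : R) :
  0 < d -> 0 <= y -> y <= z -> z - y <= m%:R * d ->
  `|g z - g y| <= m%:R * modulus_of_continuity g d.
Proof.
move=> d0 y0; elim: m z => [|m IH] z yz.
  rewrite !mul0r subr_le0 => zy.
  by rewrite (le_anti (introT andP (conj yz zy))) subrr normr0.
rewrite -natr1 !mulrDl !mul1r => zm.
have w0 := modulus_of_continuity_ge0 d d0.
have [zd|dz] := lerP (z - y) d.
  (* The modulus ranges over [h > 0] only, so the zero increment is treated apart. *)
  have [->|yneqz] := eqVneq z y.
    by rewrite subrr normr0 addr_ge0 // mulr_ge0.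
  rewrite -[X in `|g X - _|](subrK y) [_ + y]addrC.
  apply: le_trans (le_modulus_of_continuity d _ _ _ zd y0) _.
    by rewrite subr_gt0 lt_neqAle eq_sym yneqz.
  by rewrite lerDr mulr_ge0.
rewrite -(subrK (g (z - d)) (g z)) -addrA.
apply: le_trans (ler_normD _ _) _; rewrite [leRHS]addrC lerD //; last by apply: IH; lra.
rewrite -[X in `|g X - _|](subrK d).
by apply: le_modulus_of_continuity => //; lra.
Qed.

(* The square instead of [|z - y| / d] spares Cauchy-Schwarz when averaging. *)
Lemma modulus_of_continuity_bound (d y z : R) : 0 < d -> 0 <= y -> 0 <= z ->
  `|g z - g y| <= modulus_of_continuity g d * (1 + (z - y) ^+ 2 / d ^+ 2).
Proof.
move=> d0; wlog yz : y z / y <= z.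
  move=> W y0 z0; have [|/ltW] := lerP y z; first by move/W; apply.
  by move/W => /(_ z0 y0); rewrite distrC -sqrrN opprB.
move=> y0 z0; have w0 := modulus_of_continuity_ge0 d d0.
set q := (z - y) / d.
have q0 : 0 <= q by rewrite divr_ge0 ?subr_ge0 // ltW.
rewrite -expr_div_n -/q.
have zyq : z - y = q * d by rewrite /q divfK // gt_eqF.
have [q1|q1] := lerP q 1.
  apply: le_trans (le_mul_modulus_of_continuity 1 d y z d0 y0 yz _) _.
    by rewrite zyq ler_wpM2r // ltW.
  by rewrite mulrC ler_wpM2l // lerDl sqr_ge0.
(* That many steps of length [d] cover the distance from [y] to [z], and [truncn q <= q <= q^2]
   because [q > 1]. *)
have qt : q <= (Num.truncn q).+1%:R.
  by apply: ltW; have /andP[] := truncn_itv q0.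
apply: le_trans (le_mul_modulus_of_continuity (Num.truncn q).+1 d y z d0 y0 yz _) _.
  by rewrite zyq ler_wpM2r // ltW.
rewrite mulrC ler_wpM2l // -natr1 addrC lerD2l.
have /andP[tq _] := truncn_itv q0.
apply: (le_trans tq); rewrite expr2; apply: ler_peMl => //; exact: ltW.
Qed.

End Modulus.

(** * Derivatives of the operator, by differentiation under the integral sign *)

Lemma is_derive1_cvg {R : realType} (g : R -> R) (x l : R) :
  h^-1 *: (g (h + x) - g x) @[h --> (0 : R)^'] --> l -> is_derive x 1 g l.
Proof.
move=> gl; have main : h^-1 *: (g (h *: (1 : R) + x) - g x) @[h --> (0 : R)^'] --> l.
  by under eq_fun do rewrite /GRing.scale /= mulr1.
apply: DeriveDef; first by apply/cvg_ex; exists l.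
exact: cvg_lim main.
Qed.

(** At an interior point the restriction to the half line is invisible: [x + h] stays in it for
    small [h], so the restricted limit gives the two-sided one. *)
Lemma is_derive_halfline {R : realType} (g : R -> R) (x : R) :
  0 < x -> derivable_halfline g x -> is_derive x 1 g (derive_halfline g x).
Proof.
move=> x0 dg.
have shift : h + x @[h --> (0 : R)^'] --> within (half_line R) x^'.
  (* The bound [|h| < x] keeps [h + x] nonnegative. *)
  move=> A [e /= e0 Ae]; exists (Num.min e x); first by rewrite /= lt_min e0.
  move=> h /=; rewrite sub0r normrN lt_min => /andP[he hx] h0.
  apply: Ae => /=.
  - by rewrite opprD addrCA subrr addr0 normrN.
  - by rewrite -[X in _ != X]add0r (inj_eq (addIr x)).
  - rewrite half_lineE; move: hx; rewrite ltr_norml => /andP[+ _]; lra.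
apply: is_derive1_cvg.
rewrite (_ : (fun h : R => _) = halfline_quotient g x \o (fun h => h + x)).
  exact: cvg_comp shift dg.
by apply/funext => h /=; rewrite /halfline_quotient addrK mulrC.
Qed.

(** Left unnormalised: each derivative in [x] changes [a] and with it the total mass, so dividing by
    the mass is postponed to the end. *)
Definition beta_mean {R : realType} (a p : nat) (g : R -> R) (x : R) : R :=
  \int[lebesgue_measure]_(u in half_line R) (beta_weight a p u * g (x * u)).

(** Under [t = x u] the numerator yields [x^(n-k)], the differential [x], and the denominator
    [x^(2n-k+2)]; the net power [x^-(n+1)] cancels the prefactor [x^(n+1)]. *)
Lemma gamma_op_beta_mean {R : realType} (n k : nat) (f : R -> R) (x : R) :
  (k <= n)%N -> CB f -> 0 < x ->
  gamma_op n k f x = ((2 * n - k + 1)`!)%:R / ((n`!)%:R * ((n - k)`!)%:R) *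
    beta_mean (n - k) (2 * n - k + 2) f x.
Proof.
move=> kn [cf bf] x0; rewrite /gamma_op /beta_mean.
rewrite (Rintegral_half_line_scale x); last 2 first.
- by [].
- apply: within_continuous_mul => //.
  apply/subspace_continuousP => t; rewrite half_lineE => t0.
  apply: cvg_within_filter; apply: cvgM; first exact: exprn_continuous.
  apply: cvgV; first by rewrite expf_neq0 // gt_eqF // ltr_wpDr.
  apply: (@continuous_comp _ _ _ (fun s => x + s) (fun y => y ^+ (2 * n - k + 2))); last exact: exprn_continuous.
  by apply: cvgD; [exact: cvg_cst|exact: cvg_id].
have xn0 : x ^+ n.+1 != 0 by rewrite expf_neq0 // gt_eqF.
transitivity (((2 * n - k + 1)`!)%:R * x ^+ n.+1 / ((n`!)%:R * ((n - k)`!)%:R) *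
    \int[lebesgue_measure]_(u in half_line R)
      ((x ^+ n.+1)^-1 * (beta_weight (n - k) (2 * n - k + 2) u * f (x * u)))).
  congr (_ * _).
  apply: eq_Rintegral => u; rewrite inE half_lineE => u0.
  rewrite /beta_weight.
  have -> : x + x * u = x * (1 + u) by ring.
  rewrite !exprMn.
  have -> : (2 * n - k + 2 = n.+1 + (n - k).+1)%N by lia.
  rewrite !exprD !exprS; field.
  by rewrite !expf_neq0 ?gt_eqF ?ltr_pwDl.
rewrite RintegralZl; last 2 first.
- exact: measurable_half_line.
- have -> : (2 * n - k + 2 = (n - k) + n + 2)%N by lia.
  exact: integrable_beta_weight_CB.
by field; rewrite xn0 !pnatr_eq0 -!lt0n !fact_gt0.
Qed.

(** The chain rule brings out a factor [u], raising [a] to [a.+1] at the same denominator exponent.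
    Writing that exponent as [a.+1 + b + 2] keeps the new weight integrable, and a bound of [dg]
    times this weight dominates uniformly in the parameter. *)
Lemma is_derive_beta_mean {R : realType} (a b : nat) (g dg : R -> R) (x : R) :
  CB g -> CB dg -> (forall y : R, 0 < y -> is_derive y 1 g (dg y)) -> 0 < x ->
  is_derive x 1 (beta_mean a (a.+1 + b + 2) g) (beta_mean a.+1 (a.+1 + b + 2) dg x).
Proof.
move=> Cg Cdg dgE x0.
have dE (y u : R) : 0 < y -> 0 <= u -> is_derive y 1
    (fun z => beta_weight a (a.+1 + b + 2) u * g (z * u))
    (beta_weight a.+1 (a.+1 + b + 2) u * dg (y * u)).
  (* At [u = 0] the chain rule would require a derivative of [g] at 0, which is not assumed; there
     the integrand is constant in [z] and the weight with [a.+1] vanishes. *)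
  move=> y0 u0; have [->|u1] := eqVneq u 0.
    rewrite {2}/beta_weight expr0n !mul0r.
    rewrite (_ : (fun z => _) = cst (@beta_weight R a (a.+1 + b + 2) 0 * g 0)).
      exact: is_derive_cst.
    by apply/funext => z; rewrite mulr0.
  have d1 : is_derive y 1 (fun z : R => z * u) u.
    have /is_derive_eq := is_deriveM (is_derive_id y (1 : R)) (is_derive_cst u y (1 : R)).
    by apply; rewrite /GRing.scale /= mulr0 add0r mulr1.
  have yu : 0 < y * u by rewrite mulr_gt0 // lt_neqAle eq_sym u1.
  have d2 := @is_derive1_comp R g (fun z => z * u) y _ _ (dgE _ yu) d1.
  have /is_derive_eq := is_deriveZ (beta_weight a (a.+1 + b + 2) u) d2.
  apply; rewrite /beta_weight exprS /GRing.scale /=; ring.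
have [B B0 dgB] := bounded_half_line dg Cdg.2.
have p1 (y u : R) : 0 < y -> half_line R u ->
    partial1of2 (fun z u => beta_weight a (a.+1 + b + 2) u * g (z * u)) y u
    = beta_weight a.+1 (a.+1 + b + 2) u * dg (y * u).
  move=> y0; rewrite half_lineE => u0; rewrite partial1of2E.
  have d := dE y u y0 u0; exact: derive_val.
have pos (y : R) : `]0, (x + 1)[%classic y -> 0 < y.
  by rewrite /= in_itv /= => /andP[].
apply: is_derive1_cvg.
rewrite [X in _ --> X](_ : _ = \int[lebesgue_measure]_(u in half_line R)
  partial1of2 (fun z u => beta_weight a (a.+1 + b + 2) u * g (z * u)) x u); last first.
  by apply: eq_Rintegral => u; rewrite inE => hu; rewrite p1.
apply: (@cvg_differentiation_under_integral R _ _ lebesgue_measure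
  (fun z u => beta_weight a (a.+1 + b + 2) u * g (z * u)) (half_line R)
  measurable_half_line x 0 (x + 1) _ _ _
  (fun u => B * `|beta_weight a.+1 (a.+1 + b + 2) u|)).
- by rewrite /= in_itv /= x0 ltrDl ltr01.
- move=> y /pos y0.
  by rewrite (_ : a.+1 + b + 2 = a + b.+1 + 2)%N ?addSnnS //; exact: integrable_beta_weight_CB.
- by move=> y u /pos y0; rewrite half_lineE => u0; have [] := dE y u y0 u0.
- by move=> u; rewrite mulr_ge0.
- apply: integrable_EFinZl; first exact: measurable_half_line.
  exact: (integrable_abse (integrable_beta_weight a.+1 b)).
- move=> y u /pos y0 hu; rewrite p1 //; rewrite half_lineE in hu.
  by rewrite normrM mulrC ler_wpM2r // dgB // mulr_ge0 // ltW.
Qed.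

Lemma derive1n_gamma_op {R : realType} (n k r i : nat) (f : R -> R) (x : R) :
  (k <= n)%N -> (r < n)%N -> CBr r f -> (i <= r)%N -> 0 < x ->
  derive1n i (gamma_op n k f) x =
  ((2 * n - k + 1)`!)%:R / ((n`!)%:R * ((n - k)`!)%:R) *
    beta_mean (n - k + i) (2 * n - k + 2) (nderive_halfline i f) x.
Proof.
move=> kn rn [df Cf]; elim: i x => [|i IH] x ir x0.
  by rewrite addn0 derive1n0 gamma_op_beta_mean //; exact: (Cf 0%N).
rewrite derive1nS.
set C := _ / _ in IH *.
(* The induction hypothesis holds only at positive points, but the derivative depends only on values
   near [x > 0]. *)
have -> : derive1 (derive1n i (gamma_op n k f)) x =
    derive1 (fun y => C * beta_mean (n - k + i) (2 * n - k + 2) (nderive_halfline i f) y) x.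
  rewrite !derive1E; apply: near_eq_derive => //.
  near=> y; apply: IH; first exact: ltnW.
  by near: y; exact: lt_nbhsr.
(* What remains of the fixed exponent [2n-k+2] after [i.+1] derivatives; the subtraction is exact
   since [i.+1 <= r < n]. *)
pose b := (n - i.+1)%N.
have pE : (2 * n - k + 2 = (n - k + i).+1 + b + 2)%N by rewrite /b; lia.
have d : is_derive x 1 (beta_mean (n - k + i) (2 * n - k + 2) (nderive_halfline i f))
    (beta_mean (n - k + i).+1 (2 * n - k + 2) (nderive_halfline i.+1 f) x).
  rewrite pE; apply: is_derive_beta_mean => //.
  - exact/Cf/ltnW.
  - exact: Cf.
  - by move=> y y0; apply: is_derive_halfline => //; apply: df => //; exact: ltW.
have [dM eM] := d.
rewrite derive1Ml // derive1E eM -addnS.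
Unshelve. all: by end_near. Qed.

(** * Second moment about 1 and the averaged modulus estimate *)

Lemma beta_value_gt0 {R : realType} (a b : nat) : 0 < @beta_value R a b.
Proof. by rewrite divr_gt0 ?mulr_gt0 ?ltr0n ?fact_gt0. Qed.

(** Keeping [a + b] fixed keeps the denominator exponent fixed, so this is the ratio of successive
    moments of one weight. *)
Lemma beta_value_shift {R : realType} (a b : nat) :
  beta_value a.+1 b = beta_value a b.+1 * (a.+1%:R / b.+1%:R) :> R.
Proof.
rewrite /beta_value addSnnS !factS !natrM; field.
by rewrite ?pnatr_eq0 -?lt0n ?fact_gt0 ?andbT //= addrC natr1 pnatr_eq0.
Qed.

Lemma beta_weight_sqrE {R : realType} (a p : nat) (u : R) :
  beta_weight a p u * (u - 1) ^+ 2 =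
  beta_weight a.+2 p u - 2 * beta_weight a.+1 p u + beta_weight a p u.
Proof. by rewrite /beta_weight !exprS; ring. Qed.

(** The two spare units in [b.+2] pay for the two extra powers of [u]. *)
Lemma integrable_beta_weight_sqr {R : realType} (a b : nat) :
  lebesgue_measure.-integrable (half_line R)
    (EFin \o (fun u => beta_weight a (a + b.+2 + 2) u * (u - 1) ^+ 2)).
Proof.
have mH := @measurable_half_line R.
have i2 := @integrable_beta_weight R a.+2 b.
have i1 := @integrable_beta_weight R a.+1 b.+1.
have i0 := @integrable_beta_weight R a b.+2.
rewrite (_ : a.+2 + b = a + b.+2)%N in i2; last lia.
rewrite (_ : a.+1 + b.+1 = a + b.+2)%N in i1; last lia.
rewrite (_ : (fun u => _) = (fun u => beta_weight a.+2 (a + b.+2 + 2) u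
    - 2 * beta_weight a.+1 (a + b.+2 + 2) u + beta_weight a (a + b.+2 + 2) u)).
  apply: integrable_EFinD => //; apply: integrable_EFinB => //.
  exact: integrable_EFinZl.
by apply/funext => u; exact: beta_weight_sqrE.
Qed.

Lemma integral_beta_weight_sqr {R : realType} (a b : nat) :
  \int[lebesgue_measure]_(u in half_line R)
    (beta_weight a (a + b.+2 + 2) u * (u - 1) ^+ 2) =
  beta_value a b.+2 * (a.+2%:R / b.+1%:R * (a.+1%:R / b.+2%:R)
                       - 2 * (a.+1%:R / b.+2%:R) + 1).
Proof.
have mH := @measurable_half_line R.
have i2 := @integrable_beta_weight R a.+2 b.
have i1 := @integrable_beta_weight R a.+1 b.+1.
have i0 := @integrable_beta_weight R a b.+2.
have e2 := @integral_beta_weight R a.+2 b.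
have e1 := @integral_beta_weight R a.+1 b.+1.
have e0 := @integral_beta_weight R a b.+2.
rewrite (_ : a.+2 + b = a + b.+2)%N in i2 e2; last lia.
rewrite (_ : a.+1 + b.+1 = a + b.+2)%N in i1 e1; last lia.
under eq_Rintegral do rewrite beta_weight_sqrE.
have i1' := integrable_EFinZl mH i1 2.
have i21 := integrable_EFinB mH i2 i1'.
rewrite RintegralD // RintegralB // RintegralZl // /Rintegral e2 e1 e0 /=.
rewrite !beta_value_shift; ring.
Qed.

(** As [x u - x = x (u - 1)], integrating the pointwise quadratic bound leaves the mass plus
    [x^2 / d^2] times the second moment of [u - 1]. *)
Lemma beta_mean_modulus {R : realType} (a b : nat) (g : R -> R) (x d : R) :
  CB g -> 0 < x -> 0 < d ->
  `|(beta_value a b.+2)^-1 * beta_mean a (a + b.+2 + 2) g x - g x| <=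
  modulus_of_continuity g d * (1 + x ^+ 2 / d ^+ 2 *
    (a.+2%:R / b.+1%:R * (a.+1%:R / b.+2%:R) - 2 * (a.+1%:R / b.+2%:R) + 1)).
Proof.
move=> Cg x0 d0.
set V := _ - _ + 1.
have B0 := @beta_value_gt0 R a b.+2.
set B := beta_value a b.+2 in B0 *.
have mH := @measurable_half_line R.
have i0 := @integrable_beta_weight R a b.+2.
have e0 := @integral_beta_weight R a b.+2.
have ig := integrable_beta_weight_CB a b.+2 g x x0 Cg.
have isq := @integrable_beta_weight_sqr R a b.
have es := @integral_beta_weight_sqr R a b.
set p := (a + b.+2 + 2)%N in i0 e0 ig isq es *.
set w := modulus_of_continuity g d.
have ic : lebesgue_measure.-integrable (half_line R)
    (EFin \o (fun u => beta_weight a p u * g x)).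
  rewrite (_ : (fun u => _) = (fun u => g x * beta_weight a p u)).
    exact: integrable_EFinZl.
  by apply/funext => u; rewrite mulrC.
have idiff := integrable_EFinB mH ig ic.
have isq' := integrable_EFinZl mH isq (x ^+ 2 / d ^+ 2).
have isum := integrable_EFinD mH i0 isq'.
have iw := integrable_EFinZl mH isum w.
have I0 : \int[lebesgue_measure]_(u in half_line R) beta_weight a p u = B.
  by rewrite /Rintegral e0.
(* The constant [g x] moves under the integral because the weight has mass [B]. *)
have -> : B^-1 * beta_mean a p g x - g x = B^-1 *
    \int[lebesgue_measure]_(u in half_line R)
      (beta_weight a p u * g (x * u) - beta_weight a p u * g x).
  rewrite RintegralB // RintegralZr // I0 /beta_mean; field.
  by rewrite gt_eqF.
rewrite normrM gtr0_norm ?invr_gt0 // ler_pdivrMl //.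
have -> : B * (w * (1 + x ^+ 2 / d ^+ 2 * V)) =
    \int[lebesgue_measure]_(u in half_line R)
      (w * (beta_weight a p u + x ^+ 2 / d ^+ 2 * (beta_weight a p u * (u - 1) ^+ 2))).
  by rewrite RintegralZl // RintegralD // RintegralZl // I0 es -/B -/V; ring.
apply: le_trans (le_normr_Rintegral _ _) _ => //.
apply: le_Rintegral => //; first exact: (integrable_abse idiff).
move=> u; rewrite half_lineE => u0.
rewrite -mulrBr normrM ger0_norm ?beta_weight_ge0 //.
have := modulus_of_continuity_bound R g Cg.2 d x (x * u) d0 (ltW x0) (mulr_ge0 (ltW x0) u0).
move=> /(ler_wpM2l (beta_weight_ge0 a p u u0)) /le_trans; apply.
rewrite -/w le_eqVlt; apply/orP; left; apply/eqP; field.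
by rewrite gt_eqF.
Qed.

(** * Matching the constants of the operator with the beta-prime moments *)

Theorem theorem2 (R : realType) (k r : nat) (f : R -> R)
    (hk : (1 <= k)%N) (hf : CBr r f)
    (n : nat) (hnk : (k <= n)%N) (hnr : (r + 1 < n)%N)
    (x : R) (hx : 0 < x) :
  `| (b_coef R n k r)^-1 * derive1n r (gamma_op n k f) x - nderive_halfline r f x |
    <= 2 * modulus_of_continuity (nderive_halfline r f)
             (Num.sqrt (delta_n n k r x)).
Proof.
(* The assumption [r + 1 < n] is exactly what provides the two spare units: [b.+2 = n - r]. *)
have [b nE] : exists b, (n = r + b.+2)%N by exists (n - r).-2; lia.
pose a := (n - k + r)%N.
have aE : a%:R = n%:R - k%:R + r%:R :> R by rewrite natrD natrB.
have nER : n%:R = r%:R + b%:R + 2 :> R by rewrite nE natrD -addn2 natrD addrA.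
have rn : (r < n)%N by lia.
rewrite (derive1n_gamma_op n k r r) //.
rewrite (_ : 2 * n - k + 2 = a + b.+2 + 2)%N; last by rewrite /a; lia.
(* Both equal [(2n-k+1)! / ((n-k+r)! (n-r)!)], so dividing by [b(n,k,r)] normalises the weight to
   mass 1. *)
rewrite mulrA (_ : (b_coef R n k r)^-1 * _ = (beta_value a b.+2)^-1); last first.
  rewrite /b_coef /beta_value -/a (_ : n - r = b.+2)%N; last lia.
  rewrite (_ : 2 * n - k + 1 = a + b.+2 + 1)%N; last by rewrite /a; lia.
  by field; rewrite !pnatr_eq0 -!lt0n !fact_gt0.
(* The second moment of [u - 1] under the normalised weight. *)
set V := a.+2%:R / b.+1%:R * (a.+1%:R / b.+2%:R) - 2 * (a.+1%:R / b.+2%:R) + 1 : R.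
have b1 : b.+1%:R != 0 :> R by rewrite pnatr_eq0.
have b2 : b.+2%:R != 0 :> R by rewrite pnatr_eq0.
have deltaE : delta_n n k r x = V * x ^+ 2.
  rewrite /delta_n /V; congr (_ * _).
  have -> : n%:R - r%:R - 1 = b.+1%:R :> R by rewrite nER -natr1; ring.
  have -> : n%:R - r%:R = b.+2%:R :> R by rewrite nER -addn2 natrD; ring.
  have -> : a.+2%:R = n%:R - k%:R + r%:R + 2 :> R by rewrite -aE -addn2 natrD.
  have -> : a.+1%:R = n%:R - k%:R + r%:R + 1 :> R by rewrite -aE -natr1.
  have b2E : b.+2%:R = b%:R + 2 :> R by rewrite -addn2 natrD.
  have b1E : b.+1%:R = b%:R + 1 :> R by rewrite -natr1.
  rewrite nER b1E b2E in b1 b2 *; field.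
  by rewrite b1 b2.
have V0 : 0 < V.
  (* Square of the bias plus variance of the beta-prime law. *)
  rewrite (_ : V = (a.+1%:R / b.+2%:R - 1) ^+ 2 +
      a.+1%:R / (b.+1%:R * b.+2%:R ^+ 2) * (a%:R + b%:R + 3)).
    by rewrite ltr_wpDl ?sqr_ge0 // mulr_gt0 ?divr_gt0 ?mulr_gt0 ?exprn_gt0 ?ltr0n // ltr_wpDl ?addr_ge0.
  have b2E : b.+2%:R = b%:R + 2 :> R by rewrite -addn2 natrD.
  have b1E : b.+1%:R = b%:R + 1 :> R by rewrite -natr1.
  have a2E : a.+2%:R = a%:R + 2 :> R by rewrite -addn2 natrD.
  have a1E : a.+1%:R = a%:R + 1 :> R by rewrite -natr1.
  rewrite /V a1E a2E b1E b2E in b1 b2 *; field.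
  by rewrite b1 b2.
(* Strict positivity makes the square root an admissible step length [d]. *)
have d0 : 0 < delta_n n k r x by rewrite deltaE mulr_gt0 // exprn_gt0.
have := beta_mean_modulus a b _ x (Num.sqrt (delta_n n k r x)) (hf.2 r (leqnn r)) hx.
rewrite sqrtr_gt0 => /(_ d0); rewrite -/V sqr_sqrtr ?(ltW d0) // => /le_trans; apply.
(* With [d^2 = V x^2] the factor [1 + x^2 V / d^2] equals 2, the constant of the theorem. *)
rewrite {2}deltaE mulrC le_eqVlt; apply/orP; left; apply/eqP; congr (_ * _).
by field; rewrite !gt_eqF.
Qed.
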